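(* For all integers $n\ge 0$, the number $g(n)$ of receding stacks of size $n$ is equal to the number $F_0(n)$ of Frobenius symbols of size $n$ that contain a zero in the top row: $$g(n)=F_0(n).$$
   Context: A receding stack of size $n$ is a finite sequence of positive integers summing to $n$, of the form $a_1,\dots,a_r,c,b_s,b_{s-1},\dots,b_1$ with $r,s\ge 0$, such that $1\le a_1\le a_2\le\dots\le a_r\le c$ and $c> b_s\ge b_{s-1}\ge\dots\ge b_1\ge 1$, and such that every integer from $1$ to $c-1$ occurs at least once among $a_1,\dots,a_r$ and at least once among $b_1,\dots,b_s$. (Thus $c$ is the last occurrence of the largest part, and each underlying sequence is counted once.) For example, the receding stacks of size $4$ are $(1,2,1)$ and $(1,1,1,1)$, so $g(4)=2$. The generating function is $$\sum_{n\ge 0} g(n)q^n = 1+\sum_{m\ge 1}\frac{q^{m^2}}{(q)_{m-1}^2(1-q^m)},\qquad (q)_m:=\prod_{j=1}^{m}(1-q^j),$$ so that by convention $g(0)=1$. A Frobenius symbol is a pair of strictly decreasing sequences of nonnegative integers of the same length $k$, written as two rows $$\begin{pmatrix}\alpha_1 & \alpha_2 & \dots & \alpha_k\\ \beta_1 & \beta_2 & \dots & \beta_k\end{pmatrix},\qquad \alpha_1>\dots>\alpha_k\ge 0,\quad \beta_1>\dots>\beta_k\ge 0.$$ Its size is $k+\alpha_1+\dots+\alpha_k+\beta_1+\dots+\beta_k$. The top row is $(\alpha_1,\dots,\alpha_k)$.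
   Formalization: For n = 0 the value F_0(0) is set to 1 by convention (the empty symbol is counted), since literally the empty top row contains no zero and the claim would read 1 = 0. *)

(* Defs.v *)
From mathcomp Require Import all_boot.

Set Implicit Arguments.
Unset Strict Implicit.
Unset Printing Implicit Defensive.

(* [a] lists a_1, ..., a_r and [b] lists b_s, ..., b_1, both in the order in
   which they occur in the stack.  As c >= 1, the condition c > b_s, written
   [head 0 b < c], is void when [b] is empty. *)
Definition receding_around (a : seq nat) (c : nat) (b : seq nat) : bool :=
  [&& all (leq 1) (a ++ c :: b),
      sorted leq (rcons a c),
      head 0 b < c,
      sorted geq b &
      all (fun j => (j \in a) && (j \in b)) (iota 1 c.-1)].

Definition receding_stack (t : seq nat) : bool :=
  has (fun i => receding_around (take i t) (nth 0 t i) (drop i.+1 t))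
      (iota 0 (size t)).

Lemma receding_stackP (t : seq nat) :
  reflect (exists a c b, t = a ++ c :: b /\ receding_around a c b)
          (receding_stack t).
Proof.
apply: (iffP hasP) => [[i]|[a [c [b [-> acb]]]]].
  rewrite mem_iota add0n /= => lti acb.
  exists (take i t), (nth 0 t i), (drop i.+1 t); split=> //.
  by rewrite -drop_nth // cat_take_drop.
exists (size a).
  by rewrite mem_iota add0n /= size_cat /= addnS ltnS leq_addr.
rewrite take_size_cat // nth_cat ltnn subnn /=.
by rewrite drop_cat ltnNge leqnSn /= subSnn /= drop0.
Qed.

(* The parts are positive, so a stack of size [n] has at most [n] parts, each
   at most [n]: counting in the finite type [n.-bseq 'I_n.+1] misses none (see
   [receding_stack_bounded]).  The value at 0 is the convention g(0) = 1. *)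
Definition g (n : nat) : nat :=
  if n == 0 then 1
  else #|[set t : n.-bseq 'I_n.+1 |
           receding_stack (map val t) && (sumn (map val t) == n)]|.

Definition frobenius_symbol (al be : seq nat) : bool :=
  [&& size al == size be, sorted gtn al & sorted gtn be].

Definition frobenius_size (al be : seq nat) : nat :=
  size al + sumn al + sumn be.

(* A symbol of size [n] has at most [n] columns and entries at most [n] (see
   [frobenius_bounded]).  The only symbol of size 0 is the empty one, whose top
   row has no entry at all; it is counted by convention, in accordance with the
   convention g(0) = 1 and the constant term of the generating function. *)
Definition F0 (n : nat) : nat :=
  if n == 0 then 1
  else #|[set s : n.-bseq 'I_n.+1 * n.-bseq 'I_n.+1 |
           [&& frobenius_symbol (map val s.1) (map val s.2),
               frobenius_size (map val s.1) (map val s.2) == n &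
               0 \in map val s.1]]|.

Lemma bounded_bseq (n : nat) (t : seq nat) :
  size t <= n -> sumn t <= n -> exists u : n.-bseq 'I_n.+1, map val u = t.
Proof.
move=> lt_sz lt_sum.
have bound x : x \in t -> x <= n.
  by move=> xt; apply: leq_trans lt_sum; rewrite sumnE (big_rem x xt) leq_addr.
have sz : size (map (@inord n) t) <= n by rewrite size_map.
exists (@Bseq n 'I_n.+1 _ sz); rewrite /= -map_comp -[RHS]map_id.
by apply/eq_in_map => x /bound lexn /=; rewrite inordK.
Qed.

Lemma receding_stack_bounded (n : nat) (t : seq nat) :
  receding_stack t -> sumn t = n -> exists u : n.-bseq 'I_n.+1, map val u = t.
Proof.
move=> /receding_stackP[a [c [b [def_t /andP[pos _]]]]] <-.
apply: bounded_bseq => //; move: pos; rewrite -def_t.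
by elim: t {def_t} => //= x t IHt /andP[x0 /IHt]; rewrite -add1n; apply: leq_add.
Qed.

Lemma frobenius_bounded (n : nat) (al be : seq nat) :
  frobenius_symbol al be -> frobenius_size al be = n ->
  exists s : n.-bseq 'I_n.+1 * n.-bseq 'I_n.+1,
    map val s.1 = al /\ map val s.2 = be.
Proof.
rewrite /frobenius_size => /and3P[/eqP sz _ _] <-.
set m := size al + _ + _.
have [||u eq_u] := @bounded_bseq m al.
- by rewrite /m -addnA leq_addr.
- by rewrite /m addnAC leq_addl.
have [||v eq_v] := @bounded_bseq m be.
- by rewrite /m -sz -addnA leq_addr.
- by rewrite /m leq_addl.
by exists (u, v).
Qed.

(* Main.v *)
Require Import Defs.
From mathcomp Require Import all_boot.

(** Read [a] (reversed) and [b] as partitions and conjugate them: the stack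
    [a, c, b] corresponds to the symbol with [c] columns whose rows are
    [alpha_i = #{x in b | x >= i}] and [beta_i = #{x in a | x >= i}],
    [1 <= i <= c].  That every [0 < j < c] occurs in [a] and in [b] says that
    both rows are strictly decreasing, that [c] exceeds every entry of [b] says
    that [alpha_c = 0], and the size is [c + sum b + sum a] on both sides. *)

(** * Conjugation truncated or padded to a given length *)

(* The first [k] parts of the conjugate partition, padded with zeros. *)
Definition conjn (k : nat) (s : seq nat) : seq nat :=
  mkseq (fun j => count (ltn j) s) k.

Lemma size_conjn k s : size (conjn k s) = k.
Proof. by rewrite size_mkseq. Qed.

Lemma head_conjn k s : 0 < k -> head 0 (conjn k s) = count (ltn 0) s.
Proof. by case: k. Qed.

Lemma conjn_rev k s : conjn k (rev s) = conjn k s.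
Proof. by apply: eq_mkseq => j; rewrite count_rev. Qed.

Lemma conjnP k s x :
  reflect (exists2 j, j < k & x = count (ltn j) s) (x \in conjn k s).
Proof.
by apply: (iffP mapP) => -[j jk ->]; exists j; rewrite ?mem_iota // in jk *.
Qed.

Lemma count_ltnS j s : count (ltn j) s = count_mem j.+1 s + count (ltn j.+1) s.
Proof.
elim: s => //= x s ->; rewrite addnACA; congr (_ + _).
by rewrite leq_eqVlt eq_sym; case: ltngtP.
Qed.

Lemma count_iota_ltn x k : x <= k -> count (fun j => j < x) (iota 0 k) = x.
Proof.
move=> lexk; rewrite -{1}(subnKC lexk) iotaD count_cat add0n.
rewrite (@eq_in_count _ _ predT) ?count_predT ?size_iota; last first.
  by move=> j; rewrite mem_iota.
rewrite (@eq_in_count _ _ pred0) ?count_pred0 ?addn0 // => j.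
by rewrite mem_iota => /andP[+ _]; rewrite ltnNge => ->.
Qed.

(** Double counting: a part [x] adds 1 to exactly the entries with index below [x], and [x <= k]
    ensures that none of them is cut off. *)
Lemma sumn_conjn k s : all (leq^~ k) s -> sumn (conjn k s) = sumn s.
Proof.
rewrite sumnE big_map; elim: s => [|x s IHs] /= => [_|/andP[lexk /IHs <-]].
  by rewrite big1.
rewrite big_split /=; congr (_ + _).
rewrite -[RHS](count_iota_ltn _ _ lexk) -sum1_count [RHS]big_mkcond /=.
by apply: eq_bigr => j _; case: ltnP.
Qed.

Lemma geq_trans : transitive geq.
Proof. by move=> y x z /= yx zy; apply: leq_trans yx. Qed.

Lemma gtn_trans : transitive gtn.
Proof. by move=> y x z /= yx zy; apply: ltn_trans yx. Qed.

Lemma sorted_gtn_geq s : sorted gtn s -> sorted geq s.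
Proof. by apply: sub_sorted => x y /ltnW. Qed.

Lemma sorted_geq_head s x : sorted geq s -> x \in s -> x <= head 0 s.
Proof.
case: s => //= y s; rewrite (path_sortedE geq_trans) => /andP[/allP ys _].
by rewrite inE => /predU1P[->|/ys].
Qed.

(** Both sides say that the cell in row [i] and column [j] lies in the Ferrers diagram of [s]. This
    symmetry makes conjugation an involution. *)
Lemma ltn_count_ltn s i j :
  sorted geq s -> (i < count (ltn j) s) = (j < nth 0 s i).
Proof.
elim: s i => [|x s IHs] i /=; first by rewrite nth_nil.
rewrite (path_sortedE geq_trans) => /andP[/allP xs /IHs {}IHs].
have xj0 : x <= j -> count (ltn j) s = 0.
  move=> xj; rewrite (@eq_in_count _ _ pred0) ?count_pred0 // => y /xs /= yx.
  by rewrite ltnNge (leq_trans yx xj).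
by case: i => [|i] /=; case: (ltnP j x) => [jx|xj] //=; rewrite -?IHs ?(xj0 xj).
Qed.

(** Asking for [size s] entries brings back the zeros of [s], which the diagram does not see; the
    top row of a symbol needs this. *)
Lemma conjnK k s :
  sorted geq s -> all (leq^~ k) s -> conjn (size s) (conjn k s) = s.
Proof.
move=> s_sorted s_le; apply: (@eq_from_nth _ 0); rewrite size_conjn // => i lis.
rewrite nth_mkseq // count_map.
rewrite (@eq_count _ _ (fun j => j < nth 0 s i)); last first.
  by move=> j; rewrite /= ltn_count_ltn.
by rewrite count_iota_ltn //; apply: (allP s_le); apply: mem_nth.
Qed.

Lemma sorted_geq_conjn k s : sorted geq (conjn k s).
Proof.
apply: (homo_sorted (e := leq)) (iota_sorted 0 k) => i j ij.
by apply: sub_count => x; apply: leq_ltn_trans.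
Qed.

(** Neighbouring entries [i] and [i.+1] differ by the multiplicity of [i.+1] in [s]. *)
Lemma sorted_gtn_conjn k s :
  (forall j, 0 < j < k -> j \in s) -> sorted gtn (conjn k s).
Proof.
move=> s_full; apply/(sortedP 0) => i; rewrite size_conjn => lik.
rewrite !nth_mkseq ?(ltnW lik) //= [X in _ < X]count_ltnS -[X in X < _]add0n.
by rewrite ltn_add2r -has_count has_pred1 s_full.
Qed.

Lemma count_ltn_nth s j :
  sorted gtn s -> j < size s -> count (ltn (nth 0 s j)) s = j.
Proof.
elim: s j => //= x s IHs j.
rewrite (path_sortedE gtn_trans) => /andP[/allP xs /IHs {}IHs].
case: j => [_|j ljs] /=; last by rewrite IHs // (xs _ (mem_nth 0 ljs) : _ < x).
rewrite ltnn (@eq_in_count _ _ pred0) ?count_pred0 // => y /xs /= yx.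
by rewrite ltnNge ltnW.
Qed.

(** * Conjugates of the rows of a symbol *)

(** For a weakly decreasing [s] the head is the largest part, so this is the conjugate partition
    without padding. *)
Definition conj (s : seq nat) : seq nat := conjn (head 0 s) s.

Lemma conjK s : sorted geq s -> conjn (size s) (conj s) = s.
Proof.
by move=> s_sorted; apply: conjnK => //; apply/allP => x; apply: sorted_geq_head.
Qed.

Lemma sumn_conj s : sorted geq s -> sumn (conj s) = sumn s.
Proof.
by move=> s_sorted; apply: sumn_conjn; apply/allP => x; apply: sorted_geq_head.
Qed.

(** Since all parts are positive, the head of [conjn k s] is [size s], the length needed by
    [conjnK]. *)
Lemma conj_conjn k s :
    0 < k -> sorted geq s -> all (leq 1) s -> all (leq^~ k) s ->
  conj (conjn k s) = s.
Proof.
rewrite all_count => k_gt0 s_sorted /eqP s_pos s_le.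
by rewrite /conj head_conjn // s_pos conjnK.
Qed.

Lemma conj_gt0 s x : x \in conj s -> 0 < x.
Proof.
move=> /conjnP[j + ->]; case: s => //= y s jy.
by rewrite jy.
Qed.

Lemma conj_le_size s x : x \in conj s -> x <= size s.
Proof. by move=> /conjnP[j _ ->]; apply: count_size. Qed.

(** The entry 0 exceeds no threshold, so it is never counted. *)
Lemma conj_lt_size s x : 0 \in s -> x \in conj s -> x < size s.
Proof.
move=> s0 /conjnP[j _ ->]; rewrite -(count_predC (ltn j)) -[X in X < _]addn0.
by rewrite ltn_add2l -has_count; apply/hasP; exists 0.
Qed.

(** In a strictly decreasing row exactly [j] entries exceed the one at position [j]; as [j > 0],
    that entry is below the head and hence a valid index. *)
Lemma conj_full s j : sorted gtn s -> 0 < j < size s -> j \in conj s.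
Proof.
move=> s_sorted /andP[j_gt0 j_lt]; apply/conjnP.
exists (nth 0 s j); last by rewrite count_ltn_nth.
rewrite -nth0; apply: (sorted_ltn_nth gtn_trans) => //.
by rewrite inE (leq_trans _ j_lt).
Qed.

(** The split is at the last occurrence of the maximum. If [a] were shorter than [a'], then [c]
    would lie in [a'] and [c'] in [b], so [c <= c' < c]. *)
Lemma last_max_inj (a b a' b' : seq nat) c c' :
    all (leq^~ c) a -> all (ltn^~ c) b ->
    all (leq^~ c') a' -> all (ltn^~ c') b' ->
  a ++ c :: b = a' ++ c' :: b' -> [/\ a = a', c = c' & b = b'].
Proof.
wlog le_aa' : a b c a' b' c' / size a <= size a' => [IH|] a_le b_lt a'_le b'_lt.
  case: (leqP (size a) (size a')) => [|/ltnW] le; first exact: (IH _ _ _ _ _ _ le).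
  by move/esym=> e; have [] := IH _ _ _ _ _ _ le a'_le b'_lt a_le b_lt e.
move: le_aa'; rewrite leq_eqVlt => /orP[/eqP sz|lt_aa'] /eqP.
  by rewrite eqseq_cat // => /andP[/eqP-> /eqP[-> ->]].
move=> /eqP e; have c_a' : c \in a'.
  have <- : nth 0 a' (size a) = c; last exact: mem_nth.
  by have := congr1 (nth 0 ^~ (size a)) e; rewrite !nth_cat ltnn subnn lt_aa'.
have c'_b : c' \in b.
  have : c' \in drop (size a).+1 (a' ++ c' :: b').
    rewrite drop_cat; case: ltnP => [_|le]; first by rewrite mem_cat mem_head orbT.
    by rewrite (eqP (_ : _ - _ == 0)) ?mem_head // subn_eq0.
  by rewrite -e drop_cat ltnNge leqnSn /= subSnn /= drop0.
by have := leq_ltn_trans (allP a'_le _ c_a') (allP b_lt _ c'_b); rewrite ltnn.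
Qed.

(** * The bijection between symbols and stacks *)

Definition stack_of_symbol (s : seq nat * seq nat) : seq nat :=
  rev (conj s.2) ++ size s.1 :: conj s.1.

(** Shaped like the condition counted by [F0], so that membership there converts to it. *)
Definition symbol0 (n : nat) (s : seq nat * seq nat) : bool :=
  [&& frobenius_symbol s.1 s.2, frobenius_size s.1 s.2 == n & 0 \in s.1].

Lemma stack_of_symbol_receding n s : symbol0 n s ->
  receding_stack (stack_of_symbol s) && (sumn (stack_of_symbol s) == n).
Proof.
case: s => al be /and3P[/= /and3P[/eqP sz al_dec be_dec] /eqP <- al0].
have k_gt0 : 0 < size al by case: (al) al0.
apply/andP; split; last first.
  rewrite sumn_cat sumn_rev /= !sumn_conj ?sorted_gtn_geq //.
  by rewrite addnC.
apply/receding_stackP; exists (rev (conj be)), (size al), (conj al); split=> //.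
apply/and5P; split.
- apply/allP => x; rewrite mem_cat mem_rev inE.
  by case/or3P=> [/conj_gt0|/eqP->|/conj_gt0].
- rewrite -rev_cons rev_sorted /= (path_sortedE geq_trans).
  rewrite sorted_geq_conjn andbT sz.
  by apply/allP => x /conj_le_size.
(* If [conj al] is empty, the default head 0 is still below [size al]. *)
- case: (conj al) (fun x => @conj_lt_size al x al0) => //= x s; apply.
  exact: mem_head.
- exact: sorted_geq_conjn.
- apply/allP => j; rewrite mem_iota add1n prednK // => j_in.
  by rewrite mem_rev !conj_full // -sz.
Qed.

(** The stack determines its split, hence both conjugates and the common row length [c]; conjugating
    back to length [c] recovers the rows. *)
Lemma stack_of_symbol_inj n : {in symbol0 n &, injective stack_of_symbol}.
Proof.
move=> [al be] [al' be'] /and3P[/= /and3P[/eqP sz al_dec be_dec] _ al0].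
move=> /and3P[/= /and3P[/eqP sz' al'_dec be'_dec] _ al'0].
have le s t : size s = size t -> all (leq^~ (size s)) (rev (conj t)).
  by move=> ->; apply/allP => x; rewrite mem_rev => /conj_le_size.
have lt s : 0 \in s -> all (ltn^~ (size s)) (conj s).
  by move=> s0; apply/allP => x /(conj_lt_size _ _ s0).
case/last_max_inj => [||||/(can_inj revK) ebe ek eal]; rewrite ?le ?lt //=.
congr (_, _).
  by rewrite -[LHS]conjK ?sorted_gtn_geq // ek eal conjK ?sorted_gtn_geq.
by rewrite -[LHS]conjK ?sorted_gtn_geq // -sz ek sz' ebe conjK ?sorted_gtn_geq.
Qed.

Lemma stack_of_symbol_surj n t : receding_stack t -> sumn t = n ->
  exists2 s, symbol0 n s & stack_of_symbol s = t.
Proof.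
move=> /receding_stackP[a [c [b [-> /and5P[pos a_inc b_lt b_dec full]]]]] <-.
move: pos; rewrite all_cat /= => /and3P[a_pos c_gt0 b_pos].
have ra_dec : path geq c (rev a).
  by move: a_inc; rewrite -[rcons a c]revK rev_sorted rev_rcons.
move: ra_dec; rewrite (path_sortedE geq_trans) => /andP[ra_le ra_dec].
have a_le : all (leq^~ c) a by rewrite -all_rev.
have b_ltc x : x \in b -> x < c.
  by move=> /(sorted_geq_head _ _ b_dec) /leq_ltn_trans; apply.
have b_le : all (leq^~ c) b by apply/allP => x /b_ltc /ltnW.
have {}full j : 0 < j < c -> (j \in a) && (j \in b).
  by move=> j_in; apply: (allP full); rewrite mem_iota add1n prednK.
exists (conjn c b, conjn c a).
  apply/and3P; split=> /=.
  - by apply/and3P; split; rewrite ?size_conjn ?sorted_gtn_conjn // => j;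
       case/full/andP.
  - rewrite /frobenius_size size_conjn !sumn_conjn // sumn_cat /=.
    by rewrite addnC.
  (* The last entry counts the parts of [b] that are at least [c]: there are none. *)
  - apply/conjnP; exists c.-1; first by rewrite prednK.
    rewrite (@eq_in_count _ _ pred0) ?count_pred0 // => x /b_ltc /=.
    by rewrite prednK // ltnNge => /negbTE.
(* [a] is increasing, so it is reversed before [conj_conjn] applies. *)
rewrite /stack_of_symbol /= size_conjn -(conjn_rev c a).
by rewrite !conj_conjn ?revK ?all_rev.
Qed.

(** * Passage to cardinalities *)

(** Comparing images in a common type [X] lets the bijection live on plain sequences, away from the
    bounded types used for counting. *)
Lemma eq_card_code (T U : finType) (X : eqType) (A : {set T}) (B : {set U})
    (e : T -> X) (f : U -> X) :
    {in A &, injective e} -> {in B &, injective f} ->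
    (forall t, t \in A -> exists2 u, u \in B & f u = e t) ->
    (forall u, u \in B -> exists2 t, t \in A & e t = f u) ->
  #|A| = #|B|.
Proof.
move=> e_inj f_inj AB BA; rewrite !cardE -(size_map e) -(size_map f).
apply/perm_size/uniq_perm.
- by rewrite map_inj_in_uniq ?enum_uniq // => x y; rewrite !mem_enum; apply: e_inj.
- by rewrite map_inj_in_uniq ?enum_uniq // => x y; rewrite !mem_enum; apply: f_inj.
move=> x; apply/mapP/mapP => -[y]; rewrite mem_enum => yin ->.
  by have [u uB <-] := AB _ yin; exists u; rewrite ?mem_enum.
by have [t tA <-] := BA _ yin; exists t; rewrite ?mem_enum.
Qed.

Lemma map_val_bseq_inj m k : injective (fun t : m.-bseq 'I_k => map val t).
Proof. by move=> t u /(inj_map val_inj) /val_inj. Qed.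

Theorem mainTheorem5 (n : nat) : g n = F0 n.
Proof.
rewrite /g /F0; case: eqP => // _.
pose rows (s : n.-bseq 'I_n.+1 * n.-bseq 'I_n.+1) := (map val s.1, map val s.2).
(* A stack is its own code, and a symbol is coded by its stack. *)
apply: (@eq_card_code _ _ _ _ _ (fun t : n.-bseq 'I_n.+1 => map val t)
                      (fun s => stack_of_symbol (rows s))).
- by move=> t u _ _; apply: map_val_bseq_inj.
- move=> [x y] [x' y']; rewrite !inE => s_ok s'_ok.
  move/(stack_of_symbol_inj n (rows (x, y)) (rows (x', y')) s_ok s'_ok).
  by case=> /map_val_bseq_inj-> /map_val_bseq_inj->.
- move=> t; rewrite inE => /andP[t_rec /eqP t_sum].
  have [[al be] s_ok <-] := stack_of_symbol_surj _ _ t_rec t_sum.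
  have /and3P[/= fs /eqP sz _] := s_ok.
  have [s [e1 e2]] := frobenius_bounded fs sz.
  by exists s; rewrite ?inE /rows e1 e2.
- move=> s; rewrite inE => s_ok.
  have /andP[t_rec /eqP t_sum] := stack_of_symbol_receding n (rows s) s_ok.
  have [t et] := receding_stack_bounded t_rec t_sum.
  by exists t; rewrite // inE et t_rec t_sum eqxx.
Qed.
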